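(* Let $(X,\rho)$ be a proper ultrametric space and let $p \in [1,\infty)$ be a real number. Then there exists an isometric embedding of $X$ into $\ell_p$, i.e. a map $f: X \to \ell_p$ such that $\|f(x)-f(y)\|_p = \rho(x,y)$ for all $x,y\in X$.
   Context: A metric space $(X,\rho)$ is called an ultrametric space if $\rho(x,y)\le \max\{\rho(x,z),\rho(z,y)\}$ for all $x,y,z\in X$. A metric space is proper if every closed ball in it is compact. For a real number $p\ge 1$, $\ell_p$ denotes the usual Banach space of real sequences $(a_n)_{n\geq 1}$ with $\|a\|_p=(\sum_n |a_n|^p)^{1/p}<\infty$. *)

(* Defs.v *)
From mathcomp Require Export all_boot all_order all_algebra.
From mathcomp Require Export all_classical all_reals all_analysis.

Set Implicit Arguments.
Unset Strict Implicit.
Unset Printing Implicit Defensive.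

Export Order.TTheory GRing.Theory Num.Theory.
Export numFieldNormedType.Exports.

Global Open Scope classical_set_scope.
Global Open Scope ring_scope.

Definition ultrametric_space (R : realType) (X : metricType R) : Prop :=
  forall x y z : X, mdist x y <= Num.max (mdist x z) (mdist z y).

(* Not the library's [closed_ball], which is the closure of the open ball: in
   an ultrametric space that can be strictly smaller. *)
Definition cball (R : realType) (X : metricType R) (x : X) (r : R) : set X :=
  [set y | mdist x y <= r].

Definition proper_space (R : realType) (X : metricType R) : Prop :=
  forall (x : X) (r : R), compact (cball x r).

Lemma ge1E (R : realType) (p : R) : 1 <= p -> (1 <= p%:E)%E.
Proof. by rewrite lee_fin. Qed.

(* Sequences indexed by nat, from 0, with finite p-norm for the counting
   measure. This is the function space, not its quotient by almost-everywhere
   equality: only the empty set is null. See [ellP] and [ell_normE] for the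
   unfolded description by series. *)
Notation ell p1 := (LfunType (@counting nat _) (ge1E p1)).

Definition ell_norm (R : realType) (p : R) (p1 : 1 <= p) (a : ell p1) : R :=
  fine ('N[@counting nat R]_p%:E [EFin \o a])%E.

Section ell_facts.
Context (R : realType) (p : R) (p1 : 1 <= p).

Let p0 : 0 < p. Proof. exact: lt_le_trans p1. Qed.

Lemma ell_normE (a : ell p1) :
  ((ell_norm a)%:E = (\sum_(n <oo) (`|a n| `^ p)%:E) `^ p^-1)%E.
Proof. by rewrite finite_norm_fine Lnorm_counting. Qed.

Lemma ellP (u : nat -> R) :
  (\sum_(n <oo) (`|u n| `^ p)%:E < +oo)%E <-> exists a : ell p1, a =1 u.
Proof.
have normE (v : nat -> R) : finite_norm (@counting nat R) p%:E v =
    ((\sum_(n <oo) (`|v n| `^ p)%:E) `^ p^-1 < +oo)%E.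
  by rewrite /finite_norm Lnorm_counting.
have sum_ge0 (v : nat -> R) : (0 <= \sum_(n <oo) (`|v n| `^ p)%:E)%E.
  by apply: nneseries_ge0 => n _ _; rewrite lee_fin powR_ge0.
split=> [u_fin|[a /funext <-]].
  have u_norm : finite_norm (@counting nat R) p%:E u.
    by rewrite normE; exact: poweR_lty.
  have uL : u \in Lfun (@counting nat R) p%:E.
    by apply/andP; split; apply: mem_set => // _ B _.
  by exists (Lfun_Sub (ge1E p1) uL).
have := Lfunction_finite (ge1E p1) a.
rewrite normE; have := sum_ge0 a.
case: (\sum_(_ <oo) _)%E => [r _ _| _ /= | //]; first exact: ltry.
by rewrite invr_eq0 gt_eqF.
Qed.

Lemma ell_subE (a b : ell p1) n : (a - b) n = a n - b n.
Proof. by []. Qed.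

End ell_facts.

(* Main.v *)
From HB Require Import structures.
From mathcomp Require Import finmap measurable_realfun.
Require Import Defs.

Set Implicit Arguments.
Unset Strict Implicit.
Unset Printing Implicit Defensive.

(* Give each ball of X one coordinate. By properness the radius of an open ball
   can be chosen rational, and there are finitely many balls of a given radius
   in a bounded region, so there are countably many balls B_k. For a point x,
   let A x k be the set of all t > 0 such that the ball of center x and radius
   t^(1/p) is B_k; for fixed x these sets are intervals partitioning
   ]0, +oo[. By the ultrametric inequality, if x and y are both in B_k then
   A x k = A y k, and the sets A x k for B_k containing x but not y partition
   ]0, d(x,y)^p]. With g(x)_k = (|A x k| / 2)^(1/p), each of the two kinds of
   balls separating x from y contributes d(x,y)^p / 2 to the sum of the
   |g(x)_k - g(y)_k|^p. Subtracting g(x0) for a base point x0 brings g into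
   l_p. *)

Section ultrametric_balls.
Context (R : realType) (X : metricType R).

Lemma ball_mdist (x y : X) (r : R) : ball x r y <-> mdist x y < r.
Proof. by rewrite ballEmdist. Qed.

Lemma mdist_continuous (x : X) : continuous (mdist x).
Proof.
move=> y; apply/cvgrPdist_lt => e e0; near=> z.
have /ball_mdist yz : ball y e z by near: z; exact: nbhsx_ballx.
rewrite (le_lt_trans _ yz)// ler_distl lerBlDr metric_triangle/=.
by rewrite [mdist y z]metric_sym; exact: metric_triangle.
Unshelve. all: by end_near. Qed.

Hypothesis ultraX : ultrametric_space X.

Lemma ultra_ball_eq (x y : X) (r : R) : ball x r y -> ball y r = ball x r.
Proof.
move=> /ball_mdist xy; apply/seteqP; split=> z /ball_mdist xz; apply/ball_mdist.
  by rewrite (le_lt_trans (ultraX x z y))// gt_max xy.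
by rewrite (le_lt_trans (ultraX y z x))// gt_max metric_sym xy.
Qed.

Lemma ultra_ball_open (x : X) (r : R) : 0 < r -> open (ball x r).
Proof.
move=> r0; rewrite openE => y /ultra_ball_eq <-; exact: nbhsx_ballx.
Qed.

(** The ball of radius [r] around a limit point meets [ball x r], hence equals it. *)
Lemma ultra_ball_closed (x : X) (r : R) : 0 < r -> closed (ball x r).
Proof.
move=> r0 y /(_ _ (nbhsx_ballx y r r0))[z [xz yz]].
by rewrite -(ultra_ball_eq xz) (ultra_ball_eq yz); exact: ballxx.
Qed.

Hypothesis properX : proper_space X.

(* The ball is closed, hence compact, so the distance to its center attains a
   maximum, which is smaller than the radius. *)
Lemma ball_rational_radius (x : X) (r : R) : 0 < r ->
  exists q : rat, 0 < ratr q :> R /\ ball x (ratr q) = ball x r.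
Proof.
move=> r0.
have cB : compact (ball x r).
  apply: (subclosed_compact _ (@properX x r)); first exact: ultra_ball_closed.
  by move=> y /ball_mdist/ltW.
have [c /set_mem/ball_mdist xc cmax] := compact_EVT_max
  (ex_intro _ x (ballxx x r0)) cB (continuous_subspaceT (@mdist_continuous x)).
have [q] := rat_in_itvoo xc; rewrite in_itv/= => /andP[cq qr].
exists q; split; first by rewrite (le_lt_trans (mdist_ge0 x c)).
apply/seteqP; split=> y /ball_mdist xy; apply/ball_mdist.
  exact: lt_trans qr.
by rewrite (le_lt_trans _ cq)// cmax//; exact/mem_set/ball_mdist.
Qed.

(** Balls of equal radius coincide once they meet, so a finite cover of the compact [cball x0 s] by
    such balls already lists all those centered in it. *)
Lemma finite_balls (x0 : X) (s r : R) : 0 < r ->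
  finite_set [set ball x r | x in cball x0 s].
Proof.
move=> r0.
pose X' : ptopologicalType :=
  HB.pack (X : Type) (isPointed.Build X x0) (Topological.on X).
have : compact (cball x0 s : set X') by exact: properX.
rewrite compact_cover => /(_ X (cball x0 s) (ball ^~ r)) [|x xs|D _ cD].
- by move=> x _; exact: ultra_ball_open.
- by exists x => //; exact: ballxx.
have fD : finite_set [set ball x r | x in [set` D]] by exact: finite_image.
refine (sub_finite_set _ fD) => _ [x /cD[y /= Dy yx] <-].
by exists y => //; exact/esym/ultra_ball_eq.
Qed.

Lemma countable_balls :
  countable [set B : set X | exists x r, 0 < r /\ B = ball x r].
Proof.
have [[x0 _]|X0] := pselect (exists x : X, True); last first.
  apply: sub_countable (countable0 _); apply: subset_card_le => B [x].
  by case: X0; exists x.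
(* A rational radius and a bound on the distance from [x0] to the center leave only finitely many
   balls. *)
pose D : set (nat * rat) := [set nq | 0 < ratr nq.2 :> R].
pose F nq := [set ball x (ratr nq.2) | x in cball x0 nq.1%:R].
apply: (@sub_countable _ _ _ (\bigcup_(nq in D) F nq)); last first.
  apply: bigcup_countable => // nq q0; apply: finite_set_countable.
  exact: finite_balls.
apply: subset_card_le => _ [x [r [/(ball_rational_radius x)[q [q0 <-]] ->]]].
exists ((Num.truncn (mdist x0 x)).+1, q) => //; exists x => //.
by rewrite /cball/= ltW// truncnS_gt.
Qed.

End ultrametric_balls.

Section radii_partition.
Context (R : realType) (X : metricType R) (p : R).

(* The last two clauses: the ball of center [x] and radius [t `^ p^-1] contains
   [y] or not. *)
Definition radii_partition (A : X -> nat -> set R) : Prop :=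
  [/\ forall x k, measurable (A x k),
      forall x, trivIset setT (A x),
      forall x, \bigcup_k A x k = [set t | 0 < t],
      forall x y k t, A x k t -> mdist x y `^ p < t -> A y k = A x k &
      forall x y k t, A x k t -> t <= mdist x y `^ p ->
        A y k = set0 /\ A x k `<=` `]0, mdist x y `^ p]].

Lemma radii_partition_exists : ultrametric_space X -> proper_space X -> 0 < p ->
  exists A, radii_partition A.
Proof.
move=> ultraX properX p0.
have [c c_inj] := countable_injP _ (countable_balls ultraX properX).
pose B x t := ball (x : X) (t `^ p^-1).
have BP x y t : 0 < t -> B x t y <-> mdist x y `^ p < t.
  move=> t0; have {2}-> : t = (t `^ p^-1) `^ p.
    by rewrite -powRrM mulVf ?gt_eqF// powRr1// ltW.
  rewrite (leW_mono_in (le_mono_in (gt0_ltr_powR p0))) ?nnegrE ?mdist_ge0//;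
    last exact: powR_ge0.
  exact: ball_mdist.
have BE x y t : B x t y -> B y t = B x t by exact: ultra_ball_eq.
have BB x t : 0 < t -> B x t x by move=> t0; apply: ballxx; rewrite powR_gt0.
have cB x y s t : 0 < s -> 0 < t -> c (B x s) = c (B y t) -> B x s = B y t.
  move=> s0 t0 cst; apply: c_inj => //; apply/mem_set.
    by exists x, (s `^ p^-1); rewrite powR_gt0.
  by exists y, (t `^ p^-1); rewrite powR_gt0.
have BS x s t : 0 < s -> s <= t -> B x s `<=` B x t.
  move=> s0 st y /BP-/(_ s0) ys; apply/BP; first exact: lt_le_trans st.
  exact: lt_le_trans st.
exists (fun x k => [set t | 0 < t /\ c (B x t) = k]); split.
(* [B x] is increasing, so a ball obtained at two radii is obtained at all radii between them. *)
- move=> x k; apply: is_interval_measurable => s t [s0 sk] [t0 tk] u /andP[su ut].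
  have u0 : 0 < u by exact: lt_le_trans su.
  split => //; rewrite -tk; congr c; apply/seteqP; split; first exact: BS.
  by rewrite -(cB x x s t)// ?sk//; exact: BS.
- move=> x; apply/trivIsetP => i j _ _ ij; apply/seteqP; split => // t [[_ ti] [_ tj]].
  by move: ij; rewrite -ti tj eqxx.
- by move=> x; apply/seteqP; split=> [t [k _ []]//|t t0]; exists (c (B x t)).
- move=> x y k t [t0 tk] xy; have Bxy : B y t = B x t by apply: BE; exact/BP.
  apply/seteqP; split=> s [s0 sk]; split => //; rewrite -sk; congr c.
    apply: BE; rewrite (cB y x s t) ?sk ?tk//; exact: BB.
  apply: BE; have -> : B x s = B y t by apply: cB; rewrite // sk Bxy tk.
  exact: BB.
- move=> x y k t [t0 tk] xy; split.
    (* Otherwise [B x t] would also be a ball centered at [y], and so contain [y], against [xy]. *)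
    apply/seteqP; split=> // s [s0 sk].
    have /BP : B x t y by rewrite (cB x y t s) ?sk ?tk//; exact: BB.
    by move=> /(_ t0); rewrite ltNge xy.
  move=> s [s0 sk]; rewrite /= in_itv/= s0/= leNgt; apply/negP => ys.
  have /BP : B x t y by rewrite (cB x x t s) ?sk ?tk//; exact/BP.
  by move=> /(_ t0); rewrite ltNge xy.
Qed.

End radii_partition.

Section embedding.
Context (R : realType) (X : metricType R) (p : R) (p0 : 0 < p).
Context (A : X -> nat -> set R) (PA : radii_partition p A).

Let mu := @lebesgue_measure R.
Let D (x y : X) : R := mdist x y `^ p.
(** By the last two clauses of [radii_partition], this is all of [A x k] when the [k]-th ball
    contains [x] but not [y], and empty otherwise. *)
Let low x y k := A x k `&` `]0, D x y].

Let mu_segment x y : mu `]0, D x y] = (D x y)%:E.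
Proof.
rewrite /mu lebesgue_measure_itv/= lte_fin; case: ltP.
  by rewrite oppr0 adde0.
by move=> D0; congr EFin; apply/le_anti; rewrite D0 powR_ge0.
Qed.

Let measurable_low x y k : measurable (low x y k).
Proof. by case: PA => mA *; apply: measurableI => //; exact: measurable_itv. Qed.

Lemma sum_low x y : (\sum_(k <oo) mu (low x y k) = (D x y)%:E)%E.
Proof.
case: PA => mA tA UA _ _.
rewrite -mu_segment -measure_semi_bigcup//.
- congr (mu _); rewrite -setI_bigcupl UA setIidr// => t.
  by rewrite /= in_itv/= => /andP[].
- by move=> k; exact: measurable_low.
- exact/trivIset_setIr/tA.
- by apply: bigcupT_measurable => k; exact: measurable_low.
Qed.

(* The set [A x k] may have infinite measure, in which case [fine] gives [0]:
   then the [k]-th ball is the whole space and separates no points. *)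
Definition coord (x : X) (k : nat) : R := (fine (mu (A x k)) / 2) `^ p^-1.

Let coord_distE1 x y k t : A x k t -> t <= D x y ->
  (`|coord x k - coord y k| `^ p)%:E =
    (2^-1%:E * (mu (low x y k) + mu (low y x k)))%E.
Proof.
case: PA => mA _ _ _ PA5 xt txy; have [yk xk] := PA5 _ _ _ _ xt txy.
have -> : low y x k = set0 by rewrite /low yk set0I.
have -> : low x y k = A x k by rewrite /low setIidl.
rewrite /coord yk /mu !measure0 mul0r powR0 ?invr_eq0 ?gt_eqF// subr0 adde0.
rewrite ger0_norm ?powR_ge0// -powRrM mulVf ?gt_eqF// powRr1; last first.
  by rewrite divr_ge0// fine_ge0.
rewrite EFinM muleC fineK// ge0_fin_numE//.
(* [A x k] lies in the bounded interval []0, D x y]], so [fine] keeps its measure. *)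
apply: (@le_lt_trans _ _ (mu `]0, D x y])); last by rewrite mu_segment ltry.
by apply: le_measure => //; apply/mem_set; [exact: mA|exact: measurable_itv].
Qed.

Lemma coord_distE x y k :
  (`|coord x k - coord y k| `^ p)%:E =
    (2^-1%:E * (mu (low x y k) + mu (low y x k)))%E.
Proof.
have [[t [xt /=]]|x0] := pselect (low x y k !=set0).
  by rewrite in_itv/= => /andP[_]; exact: coord_distE1.
have [[t [yt /=]]|y0] := pselect (low y x k !=set0).
  by rewrite in_itv/= => /andP[_]; rewrite distrC addeC; exact: coord_distE1.
have [_ _ UA PA4 _] := PA.
have xyP z w t : ~ (low z w k !=set0) -> A z k t -> A w k = A z k.
  move=> zw0 zt; apply: (PA4 _ _ _ t) => //; rewrite ltNge; apply/negP => tD.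
  apply: zw0.
  exists t; split=> //=; rewrite in_itv/= tD andbT.
  by have : (\bigcup_k A z k) t by [exists k]; rewrite UA.
(* Here the [k]-th ball contains both points or neither. *)
have AE : A x k = A y k.
  have [[t /(xyP _ _ _ x0)//]|/set0P/negP/negbNE/eqP xE] :=
    pselect (A x k !=set0).
  have [[t /(xyP _ _ _ y0)//]|/set0P/negP/negbNE/eqP yE] :=
    pselect (A y k !=set0).
  by rewrite xE yE.
move: x0 y0 => /set0P/negP/negbNE/eqP -> /set0P/negP/negbNE/eqP ->.
by rewrite /coord AE subrr normr0 powR0 ?gt_eqF// /mu measure0 adde0 mule0.
Qed.

Lemma coord_sum x y :
  (\sum_(k <oo) (`|coord x k - coord y k| `^ p)%:E = (mdist x y `^ p)%:E)%E.
Proof.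
under eq_eseriesr do rewrite coord_distE.
rewrite nneseriesZl// ?nneseriesD//; last by move=> *; rewrite adde_ge0.
rewrite !sum_low /D [mdist y x]metric_sym -EFinD -EFinM.
by rewrite mulrDr ![2^-1 * _]mulrC -splitr.
Qed.

End embedding.

Theorem theorem1p1 (R : realType) (X : metricType R)
    (ultraX : ultrametric_space X) (properX : proper_space X)
    (p : R) (p1 : 1 <= p) :
  exists f : X -> ell p1, forall x y : X, ell_norm (f x - f y) = mdist x y.
Proof.
have p0 : 0 < p by exact: lt_le_trans p1.
have [[x0 _]|X0] := pselect (exists x : X, True); last first.
  by exists (fun=> 0) => x; case: X0; exists x.
have [A PA] := radii_partition_exists ultraX properX p0.
pose g x k := coord p A x k - coord p A x0 k.
have /choice[f fE] x : exists a : ell p1, a =1 g x.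
  by apply/ellP; rewrite coord_sum// ltry.
exists f => x y; apply: EFin_inj; rewrite ell_normE.
under eq_eseriesr do rewrite ell_subE !fE /g opprB addrA subrK.
rewrite coord_sum// poweR_EFin -powRrM mulfV ?gt_eqF// powRr1//.
exact: mdist_ge0.
Qed.
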